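(* Let $f:\mathbb{R}^n\to\mathbb{R}$ be twice continuously differentiable with $L$-Lipschitz gradient, and let $x^*$ be a strict saddle point of $f$. If $\{x_k\}_{k\ge0}$ is generated by the PBCD method with step size $0<\alpha<\frac1L$ from an initial point $x_0$ distributed according to $\nu$, then $$\mathbb{P}_\nu\left[\lim_{k\to\infty}x_k=x^*\right]=0.$$
   Context: $\|\nabla f(x)-\nabla f(y)\|\le L\|x-y\|$ for all $x,y$, with $L>0$. The variable is partitioned as $x=(x(1),\dots,x(p))$, $x(t)\in\mathbb{R}^{n_t}$, $\sum_t n_t=n$. PBCD (proximal block coordinate descent) method: given $x_k$, set $x_k^0=x_k$ and for $s=1,\dots,p$ let $x_k^s(s)$ be the (unique) minimizer over $u\in\mathbb{R}^{n_s}$ of $f(x_k^{s-1}(1),\dots,x_k^{s-1}(s-1),u,x_k^{s-1}(s+1),\dots,x_k^{s-1}(p))+\frac{1}{2\alpha}\|u-x_k^{s-1}(s)\|_2^2$, and $x_k^s(t)=x_k^{s-1}(t)$ for $t\ne s$; then $x_{k+1}=x_k^p$. A strict saddle is a point $x^*$ with $\nabla f(x^* )=0$ and $\lambda_{\min}(\nabla^2 f(x^* ))<0$. $\nu$ is a probability measure on $\mathbb{R}^n$ absolutely continuous with respect to Lebesgue measure. *)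

(* Defs.v *)
From HB Require Import structures.
From mathcomp Require Import all_boot all_order all_algebra.
From mathcomp Require Import all_classical all_reals all_analysis.
Set Implicit Arguments. Unset Strict Implicit. Unset Printing Implicit Defensive.
Import Order.TTheory GRing.Theory Num.Theory numFieldNormedType.Exports.
Local Open Scope classical_set_scope.
Local Open Scope ring_scope.

Section defs.
Variables (R : realType) (n : nat).
Notation V := 'rV[R]_n.

Definition ebasis (i : 'I_n) : V := delta_mx 0 i.

Definition partial (i : 'I_n) (f : V -> R) : V -> R :=
  fun x => derive f x (ebasis i).

Definition grad (f : V -> R) (x : V) : V := \row_i partial i f x.
Definition hessian (f : V -> R) (x : V) : 'M[R]_n :=
  \matrix_(i, j) partial j (partial i f) x.

Definition C2 (f : V -> R) : Prop :=
  continuous f /\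
  (forall i x, derivable f x (ebasis i)) /\
  (forall i, continuous (partial i f)) /\
  (forall i j x, derivable (partial i f) x (ebasis j)) /\
  (forall i j, continuous (partial j (partial i f))).

Definition enorm (v : V) : R := Num.sqrt (\sum_i v 0 i ^+ 2).

Definition grad_lipschitz (f : V -> R) (L : R) : Prop :=
  forall x y, enorm (grad f x - grad f y) <= L * enorm (x - y).

Definition strict_saddle (f : V -> R) (xs : V) : Prop :=
  grad f xs = 0 /\ exists lam : R, eigenvalue (hessian f xs) lam /\ lam < 0.

(* Contiguous partition of coordinates into p blocks of sizes nt t:
   coordinate i belongs to block s iff
   n_1 + ... + n_{s-1} <= i < n_1 + ... + n_s  (0-indexed blocks). *)
Definition in_block (p : nat) (nt : 'I_p -> nat) (s : 'I_p) (i : 'I_n) : bool :=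
  ((\sum_(t < p | (t < s)%N) nt t <= i)%N && (i < \sum_(t < p | (t <= s)%N) nt t)%N).

(* The proximal block-s update of x: the minimizer, over points y agreeing
   with x outside block s, of f y + 1/(2 alpha) ||y(s) - x(s)||^2
   (= f y + 1/(2 alpha) ||y - x||^2 since y - x vanishes outside block s). *)
Definition block_argmin (f : V -> R) (alpha : R) (p : nat) (nt : 'I_p -> nat)
    (s : 'I_p) (x : V) : set V :=
  [set y : V | (forall i, ~~ in_block nt s i -> y 0 i = x 0 i) /\
     forall z : V, (forall i, ~~ in_block nt s i -> z 0 i = x 0 i) ->
       f y + (2 * alpha)^-1 * enorm (y - x) ^+ 2 <=
       f z + (2 * alpha)^-1 * enorm (z - x) ^+ 2].

Definition block_step f alpha p (nt : 'I_p -> nat) s (x : V) : V :=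
  xget 0 (block_argmin f alpha nt s x).

Definition pbcd_sweep f alpha p (nt : 'I_p -> nat) (x : V) : V :=
  foldl (fun y s => block_step f alpha nt s y) x (enum 'I_p).

Definition pbcd f alpha p (nt : 'I_p -> nat) (k : nat) (x0 : V) : V :=
  iter k (pbcd_sweep f alpha nt) x0.

End defs.

(* identify a point of R^n given as an n-tuple (the measurable-space model
   of R^n, with the product = Borel sigma-algebra) with a row vector *)
Definition tuple_to_row (R : realType) (n : nat) (t : n.-tuple R) : 'rV[R]_n :=
  \row_i tnth t i.

Definition box (R : realType) (n : nat) (a b : 'I_n -> R) : set (n.-tuple R) :=
  [set t | forall i, a i <= tnth t i <= b i].
Definition box_vol (R : realType) (n : nat) (a b : 'I_n -> R) : R :=
  \prod_i (b i - a i).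

Definition lebesgue_null (R : realType) (n : nat) (A : set (n.-tuple R)) : Prop :=
  forall eps : R, 0 < eps -> exists a b : nat -> 'I_n -> R,
    (forall k i, a k i <= b k i) /\
    A `<=` \bigcup_k box (a k) (b k) /\
    forall N, \sum_(k < N) box_vol (a k) (b k) <= eps.

Definition abs_cont_lebesgue (R : realType) (n : nat)
    (nu : set (n.-tuple R) -> \bar R) : Prop :=
  forall A : set (n.-tuple R), measurable A -> lebesgue_null A -> nu A = 0%E.

(* Main.v *)
Require Import Defs.
From HB Require Import structures.
From mathcomp Require Import all_boot all_order all_algebra.
From mathcomp Require Import all_classical all_reals all_analysis.
From mathcomp Require Import measurable_realfun.
From mathcomp Require Import ring lra.
Import Order.TTheory GRing.Theory Num.Theory numFieldNormedType.Exports.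
Local Open Scope classical_set_scope.
Local Open Scope ring_scope.
Set Implicit Arguments. Unset Strict Implicit. Unset Printing Implicit Defensive.

(** Let [H] be the Hessian at the saddle and [q v = v H v^T]. A block step is implicit,
    [y = x - alpha P (grad f y)] with [P] the projection on the block, hence bilipschitz.
    Compare two orbits near the saddle, with difference [v]: a sweep that displaces [v]
    by [S] lowers [q v] by a multiple of [S ^+ 2], up to a small error. As [H] is
    symmetric, [|q v| <= (K |v H|) ^+ 2], so that for small [tau] the displacement is at
    least of order [tau |v|] on the cone [q v + tau ^+ 2 |v| ^+ 2 <= 0], and this form
    does not increase along sweeps that start in the cone. If both orbits tend to the
    saddle the form tends to [0], so that their difference can never have been in the
    interior of the cone, which is nonempty since [H] has a negative eigenvalue. The
    points whose orbits stay close and converge thus form a Lipschitz graph over a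
    hyperplane; pulling this null set back through the iterates of the sweep exhausts
    the basin of the saddle. No stable manifold is constructed. *)

Section dot_product.
Context {R : comPzRingType} {n : nat}.
Implicit Types (u v w : 'rV[R]_n) (A : 'M[R]_n).

Definition dotv u v : R := \sum_i u 0 i * v 0 i.

Lemma dotvC u v : dotv u v = dotv v u.
Proof. by apply: eq_bigr => i _; rewrite mulrC. Qed.

Lemma dotvDl u v w : dotv (u + v) w = dotv u w + dotv v w.
Proof. by rewrite /dotv -big_split; apply: eq_bigr => i _; rewrite mxE mulrDl. Qed.

Lemma dotvZl (a : R) u v : dotv (a *: u) v = a * dotv u v.
Proof. by rewrite /dotv mulr_sumr; apply: eq_bigr => i _; rewrite mxE mulrA. Qed.

Lemma dotvNl u v : dotv (- u) v = - dotv u v.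
Proof. by rewrite -scaleN1r dotvZl mulN1r. Qed.

Lemma dotvBl u v w : dotv (u - v) w = dotv u w - dotv v w.
Proof. by rewrite dotvDl dotvNl. Qed.

Lemma dotv0l v : dotv 0 v = 0.
Proof. by rewrite -(scale0r v) dotvZl mul0r. Qed.

Lemma dotvDr u v w : dotv u (v + w) = dotv u v + dotv u w.
Proof. by rewrite !(dotvC u) dotvDl. Qed.

Lemma dotvZr (a : R) u v : dotv u (a *: v) = a * dotv u v.
Proof. by rewrite !(dotvC u) dotvZl. Qed.

Lemma dotvBr u v w : dotv u (v - w) = dotv u v - dotv u w.
Proof. by rewrite !(dotvC u) dotvBl. Qed.

Lemma dotv0r u : dotv u 0 = 0.
Proof. by rewrite dotvC dotv0l. Qed.

Lemma dotv_delta u i : dotv u (delta_mx 0 i) = u 0 i.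
Proof.
rewrite /dotv (bigD1 i) //= big1 => [|j ji]; first by rewrite mxE !eqxx mulr1 addr0.
by rewrite mxE (negbTE ji) andbF mulr0.
Qed.

Lemma dotv_mulmx A u v : dotv (u *m A) v = dotv u (v *m A^T).
Proof.
have dotvE w z : dotv w z = (w *m z^T) 0 0.
  by rewrite mxE; apply: eq_bigr => i _; rewrite mxE.
by rewrite !dotvE trmx_mul trmxK mulmxA.
Qed.

Definition quad A v : R := dotv (v *m A) v.

Lemma quadD A u v :
  quad A (u + v) = quad A u + dotv (u *m A) v + dotv (v *m A) u + quad A v.
Proof. by rewrite /quad mulmxDl !dotvDl !dotvDr; ring. Qed.

Lemma quadZ A (a : R) v : quad A (a *: v) = a ^+ 2 * quad A v.
Proof. by rewrite /quad -scalemxAl dotvZl dotvZr mulrA. Qed.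

Lemma quadB_sym A u v : A^T = A ->
  quad A (u - v) = quad A u - 2 * dotv (u *m A) v + quad A v.
Proof.
move=> symA; rewrite /quad mulmxBl !dotvBl !dotvBr.
by rewrite (dotv_mulmx A v u) symA (dotvC v); ring.
Qed.

End dot_product.

Section euclidean_norm.
Context {R : realType} {n : nat}.
Implicit Types (u v w x y : 'rV[R]_n) (A : 'M[R]_n).

Lemma enorm_ge0 u : 0 <= enorm u.
Proof. exact: sqrtr_ge0. Qed.

Lemma sqr_enorm u : enorm u ^+ 2 = dotv u u.
Proof.
rewrite sqr_sqrtr; first by apply: eq_bigr => i _; rewrite expr2.
by apply: sumr_ge0 => i _; rewrite sqr_ge0.
Qed.

Lemma enorm_leE u (c : R) : 0 <= c -> (enorm u <= c) = (dotv u u <= c ^+ 2).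
Proof. by move=> c0; rewrite -sqr_enorm ler_pXn2r ?nnegrE ?enorm_ge0. Qed.

Lemma quad_add_scalar A (c : R) u : quad (A + c%:M) u = quad A u + c * enorm u ^+ 2.
Proof. by rewrite sqr_enorm /quad mulmxDr mul_mx_scalar dotvDl dotvZl. Qed.

Lemma enorm0 : enorm (0 : 'rV[R]_n) = 0.
Proof. by apply/eqP; rewrite -sqrf_eq0 sqr_enorm dotv0r. Qed.

Lemma enormZ (a : R) u : enorm (a *: u) = `|a| * enorm u.
Proof.
rewrite /enorm; under eq_bigr do rewrite mxE exprMn.
by rewrite -mulr_sumr sqrtrM ?sqr_ge0 // sqrtr_sqr.
Qed.

Lemma enormN u : enorm (- u) = enorm u.
Proof. by rewrite -scaleN1r enormZ normrN1 mul1r. Qed.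

Lemma enorm_distC u v : enorm (u - v) = enorm (v - u).
Proof. by rewrite -enormN opprB. Qed.

Lemma normr_coord_le_enorm u i : `|u 0 i| <= enorm u.
Proof.
rewrite -sqrtr_sqr; apply: ler_wsqrtr.
by rewrite (bigD1 i) //= lerDl sumr_ge0 // => j _; rewrite sqr_ge0.
Qed.

Lemma enorm_eq0 u : (enorm u == 0) = (u == 0).
Proof.
apply/eqP/eqP => [u0|->]; last exact: enorm0.
apply/rowP => i; rewrite mxE; apply/eqP.
by rewrite -normr_le0 -u0 normr_coord_le_enorm.
Qed.

Lemma enorm_gt0 u : (0 < enorm u) = (u != 0).
Proof. by rewrite lt_neqAle enorm_ge0 andbT eq_sym enorm_eq0. Qed.

Lemma dotv_le_enorm u v : dotv u v <= enorm u * enorm v.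
Proof.
have [->|u_neq0] := eqVneq u 0; first by rewrite dotv0l enorm0 mul0r.
have [->|v_neq0] := eqVneq v 0; first by rewrite dotv0r enorm0 mulr0.
have uv_gt0 : 0 < 2 * (enorm u * enorm v) by rewrite !mulr_gt0 ?enorm_gt0.
have : 0 <= enorm (enorm v *: u - enorm u *: v) ^+ 2 by rewrite sqr_ge0.
have -> : enorm (enorm v *: u - enorm u *: v) ^+ 2 =
    2 * (enorm u * enorm v) * (enorm u * enorm v - dotv u v).
  rewrite sqr_enorm !(dotvBl, dotvBr, dotvZl, dotvZr).
  by rewrite (dotvC v u) -!sqr_enorm; ring.
by rewrite pmulr_rge0 // subr_ge0.
Qed.

Lemma normr_dotv_le u v : `|dotv u v| <= enorm u * enorm v.
Proof.
by rewrite ler_norml dotv_le_enorm andbT lerNl -dotvNl -(enormN u) dotv_le_enorm.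
Qed.

Lemma sqr_enormD u v :
  enorm (u + v) ^+ 2 = enorm u ^+ 2 + 2 * dotv u v + enorm v ^+ 2.
Proof. by rewrite !sqr_enorm dotvDl !dotvDr (dotvC v u); ring. Qed.

Lemma ler_enormD u v : enorm (u + v) <= enorm u + enorm v.
Proof.
rewrite -(@ler_pXn2r _ 2) ?nnegrE ?addr_ge0 ?enorm_ge0 // sqr_enormD sqrrD.
by have := dotv_le_enorm u v; lra.
Qed.

Lemma ler_enormB u v : enorm (u - v) <= enorm u + enorm v.
Proof. by rewrite -(enormN v) ler_enormD. Qed.

Lemma ler_enorm_distD w u v : enorm (u - v) <= enorm (u - w) + enorm (w - v).
Proof. by have := ler_enormD (u - w) (w - v); rewrite addrA subrK. Qed.

Lemma ler_enorm_dist u v : `|enorm u - enorm v| <= enorm (u - v).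
Proof.
have := ler_enormD (u - v) v; have := ler_enormD (v - u) u.
rewrite !subrK (enorm_distC v) => vu uv.
by rewrite ler_norml; apply/andP; split; lra.
Qed.

Lemma ler_enorm_coord u v :
  (forall i, `|u 0 i| <= `|v 0 i|) -> enorm u <= enorm v.
Proof.
move=> uv; apply: ler_wsqrtr; apply: ler_sum => i _.
by rewrite -real_normK ?num_real // -[leRHS]real_normK ?num_real // ler_pXn2r ?nnegrE.
Qed.

Lemma enorm_le_sum u : enorm u <= \sum_i `|u 0 i|.
Proof.
rewrite enorm_leE ?sumr_ge0 // expr2 mulr_suml; apply: ler_sum => i _.
rewrite -expr2 -real_normK ?num_real // expr2 ler_wpM2l //.
by rewrite (bigD1 i) //= lerDl sumr_ge0.
Qed.

Lemma enorm_le_const u (c : R) : (forall i, `|u 0 i| <= c) -> enorm u <= n%:R * c.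
Proof.
move=> uc; apply: le_trans (enorm_le_sum u) _.
by rewrite mulr_natl -[X in _ *+ X](card_ord n) -sumr_const ler_sum.
Qed.

Lemma sum_normr_coord_le u : \sum_i `|u 0 i| <= n%:R * enorm u.
Proof.
rewrite mulr_natl -[X in _ *+ X](card_ord n) -sumr_const.
by apply: ler_sum => i _; exact: normr_coord_le_enorm.
Qed.

Lemma normr_le_enorm u : `|u| <= enorm u.
Proof.
rewrite [leLHS]mx_normrE; apply: bigmax_le => [|[i j] _]; first exact: enorm_ge0.
by rewrite ord1 normr_coord_le_enorm.
Qed.

Lemma enorm_le_normr u : enorm u <= n%:R * `|u|.
Proof.
apply: enorm_le_const => i; rewrite [leRHS]mx_normrE.
exact: (le_bigmax _ (fun ij => `|u ij.1 ij.2|) (0, i)).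
Qed.

Lemma enorm_delta i : enorm (delta_mx 0 i : 'rV[R]_n) = 1.
Proof.
rewrite -[LHS]ger0_norm ?enorm_ge0 // -sqrtr_sqr sqr_enorm dotv_delta.
by rewrite mxE !eqxx sqrtr1.
Qed.

Lemma enorm_mulmx_bounded A :
  exists2 K : R, 0 <= K & forall u, enorm (u *m A) <= K * enorm u.
Proof.
exists (\sum_j \sum_i `|A i j|); first by do 2!(apply: sumr_ge0 => ? _).
move=> u; apply: le_trans (enorm_le_sum _) _; rewrite mulr_suml.
apply: ler_sum => j _; rewrite mxE mulr_suml.
apply: le_trans (ler_norm_sum _ _ _) _; apply: ler_sum => i _.
by rewrite normrM mulrC ler_wpM2l // normr_coord_le_enorm.
Qed.

Lemma normr_quad_le A (K : R) v :
  (forall u, enorm (u *m A) <= K * enorm u) -> `|quad A v| <= K * enorm v ^+ 2.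
Proof.
move=> A_le; apply: le_trans (normr_dotv_le _ _) _.
by rewrite expr2 mulrA ler_wpM2r ?enorm_ge0.
Qed.

(* A pseudo-inverse [P] of [A] turns [u A u^T] into [(u A) P (u A)^T]. *)
Lemma symmetric_quad_le_sqr A : A^T = A ->
  exists2 K : R, 0 < K & forall u, `|quad A u| <= (K * enorm (u *m A)) ^+ 2.
Proof.
move=> symA; have [K K0 P_le] := enorm_mulmx_bounded (pinvmx A).
exists (K + 1) => [|u]; first by rewrite ltr_wpDl.
have -> : quad A u = quad (pinvmx A) (u *m A).
  by rewrite /quad -{4}symA -dotv_mulmx mulmxKpV // submxMl.
apply: le_trans (normr_quad_le _ P_le) _.
rewrite exprMn ler_wpM2r ?sqr_ge0 // sqrrD1.
by have := sqr_ge0 K; lra.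
Qed.

End euclidean_norm.

Lemma cvg0_normr_le {R : realFieldType} {V : normedModType R} {I : Type}
    (F : set_system I) {FF : Filter F} (u : I -> V) (h : I -> R) :
  (forall i, `|u i| <= h i) -> h i @[i --> F] --> 0 -> u i @[i --> F] --> 0.
Proof.
move=> u_le h0; apply/norm_cvg0P; apply: squeeze_cvgr (cvg_cst 0) h0.
by apply: nearW => i; rewrite normr_ge0 u_le.
Qed.

Section euclidean_topology.
Context {R : realType} {n : nat}.
Implicit Types (x y l : 'rV[R]_n) (T : 'rV[R]_n -> 'rV[R]_n).

Lemma cvg_enormP {I : Type} (F : set_system I) {FF : Filter F}
    (u : I -> 'rV[R]_n) l :
  u i @[i --> F] --> l <-> enorm (u i - l) @[i --> F] --> 0.
Proof.
rewrite -subr_cvg0; split => u_to_l; last first.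
  by apply: cvg0_normr_le u_to_l => i; exact: normr_le_enorm.
apply: (cvg0_normr_le (h := fun i => n%:R * `|u i - l|)) => [i|].
  by rewrite ger0_norm ?enorm_ge0 ?enorm_le_normr.
rewrite -[X in _ --> X](mulr0 n%:R); apply: cvgM; first exact: cvg_cst.
exact/norm_cvg0P.
Qed.

Lemma cvg_enorm {I : Type} (F : set_system I) {FF : Filter F}
    (u : I -> 'rV[R]_n) l :
  u i @[i --> F] --> l -> enorm (u i) @[i --> F] --> enorm l.
Proof.
move=> /cvg_enormP u_to_l; apply/subr_cvg0.
by apply: cvg0_normr_le u_to_l => i; exact: ler_enorm_dist.
Qed.

Lemma enorm_dist_continuous l : continuous (fun x : 'rV[R]_n => enorm (x - l)).
Proof.
move=> x; apply: (@cvg_enorm _ _ (nbhs_filter x)).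
by apply: (@cvgB _ _ _ _ (nbhs_filter x)) => //; exact: cvg_cst.
Qed.

Lemma cvg_quad0 {I : Type} (F : set_system I) {FF : Filter F}
    (A : 'M[R]_n) (u : I -> 'rV[R]_n) :
  u i @[i --> F] --> (0 : 'rV[R]_n) -> quad A (u i) @[i --> F] --> 0.
Proof.
move=> /cvg_enormP u0; have [K _ A_le] := enorm_mulmx_bounded A.
apply: (cvg0_normr_le (h := fun i => K * enorm (u i - 0) ^+ 2)) => [i|].
  by rewrite subr0 normr_quad_le.
rewrite -[X in _ --> X](mulr0 K) -[X in K * X](mulr0 0).
by apply: cvgM; [exact: cvg_cst | exact: cvgM].
Qed.

Definition eball x (r : R) : set 'rV[R]_n := [set y | enorm (y - x) <= r].

Lemma eball_subset_ball x (r s : R) : r < s -> eball x r `<=` ball x s.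
Proof.
move=> rs y yr; rewrite -ball_normE /ball_ /=.
by apply: le_lt_trans rs; rewrite (le_trans (normr_le_enorm _)) // enorm_distC.
Qed.

Lemma closed_eball x (r : R) : closed (eball x r).
Proof.
apply: (@preimage_closed _ _ (fun y => enorm (y - x)) [set s | s <= r]).
  by move=> y _; exact: enorm_dist_continuous.
exact: closed_le.
Qed.

Lemma compact_eball x (r : R) : compact (eball x r).
Proof.
apply: bounded_closed_compact; last exact: closed_eball.
exists (enorm x + r); split; first exact: num_real.
move=> M rM y yr; apply: le_trans (normr_le_enorm _) _; apply: le_trans (ltW rM).
by rewrite -[y](subrK x) addrC (le_trans (ler_enormD _ _)) // lerD2l.
Qed.

Definition bilipschitz T := exists2 K : R, 0 < K & forall x y,
  enorm (T x - T y) <= K * enorm (x - y) /\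
  enorm (x - y) <= K * enorm (T x - T y).

Lemma bilipschitz_id : bilipschitz id.
Proof. by exists 1 => // x y; rewrite mul1r. Qed.

Lemma bilipschitz_comp T U : bilipschitz T -> bilipschitz U -> bilipschitz (T \o U).
Proof.
move=> [K K0 T_bilip] [M M0 U_bilip]; exists (K * M) => [|x y]; first exact: mulr_gt0.
have [T_le T_ge] := T_bilip (U x) (U y); have [U_le U_ge] := U_bilip x y.
split; first by rewrite (le_trans T_le) // -mulrA ler_wpM2l // ltW.
by rewrite (le_trans U_ge) // (mulrC K) -mulrA ler_wpM2l // ltW.
Qed.

Lemma bilipschitz_iter T k : bilipschitz T -> bilipschitz (iter k T).
Proof.
move=> T_bilip; elim: k => [|k]; [exact: bilipschitz_id | exact: bilipschitz_comp].
Qed.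

Lemma bilipschitz_foldl {I : Type} (T : I -> 'rV[R]_n -> 'rV[R]_n) (s : seq I) :
  (forall i, bilipschitz (T i)) -> bilipschitz (foldl (fun x i => T i x) ^~ s).
Proof.
move=> T_bilip; elim: s => [|i s IHs]; first exact: bilipschitz_id.
exact: bilipschitz_comp IHs (T_bilip i).
Qed.

Lemma bilipschitz_continuous T : bilipschitz T -> continuous T.
Proof.
move=> [K K0 T_bilip] x.
have dist_cvg0 : enorm (y - x) @[y --> x] --> 0.
  by have := @enorm_dist_continuous x x; rewrite /continuous_at subrr enorm0.
apply/(@cvg_enormP _ _ (nbhs_filter x)).
apply: (@cvg0_normr_le _ _ _ _ (nbhs_filter x) _ (fun y => K * enorm (y - x))) => [y|].
  by rewrite ger0_norm ?enorm_ge0 //; have [] := T_bilip y x.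
rewrite -[X in _ --> X](mulr0 K).
by apply: (@cvgM _ _ _ (nbhs_filter x)) => //; exact: cvg_cst.
Qed.

Lemma bilipschitz_fixpoint_eball T a (r : R) : bilipschitz T -> T a = a -> 0 < r ->
  exists2 r' : R, 0 < r' & forall x, eball a r' x -> eball a r (T x).
Proof.
move=> [K K0 T_bilip] Ta r0; exists (r / K) => [|x]; first exact: divr_gt0.
rewrite /eball /= ler_pdivlMr // mulrC; apply: le_trans.
by rewrite -{1}Ta; have [] := T_bilip x a.
Qed.

End euclidean_topology.

Lemma is_derive_line {R : numFieldType} {V W : normedModType R} (g : V -> W) x v t dg :
  is_derive (x + t *: v) v g dg -> is_derive t 1 (fun s => g (x + s *: v)) dg.
Proof.
move=> [g_derivable g_derive].
have lineE : (fun h : R => h^-1 *: (((fun s => g (x + s *: v)) \o shift t) (h *: 1)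
    - g (x + t *: v))) =
  (fun h : R => h^-1 *: ((g \o shift (x + t *: v)) (h *: v) - g (x + t *: v))).
  apply/funext => h /=; congr (_ *: (g _ - _)).
  by rewrite [h *: 1]mulr1 scalerDl addrCA addrA.
by split; [rewrite /derivable lineE | rewrite /derive lineE].
Qed.

Lemma is_derive_continuous {R : realType} (phi dphi : R -> R) :
  (forall t : R, is_derive t 1 phi (dphi t)) -> continuous phi.
Proof.
move=> phi_derive t; apply/differentiable_continuous/derivable1_diffP.
by have [] := phi_derive t.
Qed.

Lemma affine_approx_le {R : realType} (phi dphi : R -> R) (d a eps : R) :
  (forall t : R, is_derive t 1 phi (dphi t)) ->
  (forall t, `|t| <= `|d| -> `|dphi t - a| <= eps) ->
  `|phi d - phi 0 - a * d| <= eps * `|d|.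
Proof.
move=> phi_derive dphi_near.
have phi_cont A : {within A, continuous phi}.
  exact/continuous_subspaceT/is_derive_continuous.
have [d_ge0|d_lt0] := leP 0 d.
  have [t tI ->] := MVT_segment d_ge0 (fun t _ => phi_derive t) (phi_cont _).
  rewrite subr0 -mulrBl normrM ler_wpM2r // dphi_near //.
  by rewrite !ger0_norm ?(itvP tI).
have [t tI phiE] := MVT_segment (ltW d_lt0) (fun t _ => phi_derive t) (phi_cont _).
rewrite -[phi d - _]opprB phiE sub0r mulrN opprK -mulrBl normrM ler_wpM2r // dphi_near //.
by rewrite !ler0_norm ?lerN2 ?(itvP tI) // ltW.
Qed.

Section first_order.
Context {R : realType} {n : nat}.
Implicit Types (x y z v a : 'rV[R]_n) (g : 'rV[R]_n -> R).

Definition C1 g :=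
  (forall i x, derivable g x (ebasis R i)) /\ (forall i, continuous (partial i g)).

Definition splice x y (k : nat) : 'rV[R]_n :=
  \row_j (if (j < k)%N then x 0 j else y 0 j).

Lemma spliceS x y (k : 'I_n) :
  splice x y k.+1 = splice x y k + (x - y) 0 k *: ebasis R k.
Proof.
apply/rowP => j; rewrite !mxE eqxx /= ltnS leq_eqVlt.
have [->|jk] := eqVneq j k; first by rewrite eqxx /= ltnn mulr1 addrC subrK.
by rewrite (inj_eq val_inj) (negbTE jk) mulr0 addr0.
Qed.

Lemma splice_segment_eball x y (k : 'I_n) (t : R) : `|t| <= `|(x - y) 0 k| ->
  eball y (enorm (x - y)) (splice x y k + t *: ebasis R k).
Proof.
move=> t_le; apply: ler_enorm_coord => j; rewrite !mxE eqxx /=.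
have [->|jk] := eqVneq j k.
  by rewrite ltnn mulr1 addrAC subrr add0r; move: t_le; rewrite !mxE.
by rewrite mulr0 addr0; case: ifP => // _; rewrite subrr normr0.
Qed.

(* One coordinate is moved at a time, so that only partial derivatives occur. *)
Lemma partials_approx_le g a x y (eps : R) :
  (forall i z, derivable g z (ebasis R i)) ->
  (forall i z, eball y (enorm (x - y)) z -> `|partial i g z - a 0 i| <= eps) ->
  `|g x - g y - dotv a (x - y)| <= eps * \sum_i `|(x - y) 0 i|.
Proof.
move=> g_derivable partial_near.
have -> : g x - g y = \sum_(k < n) (g (splice x y k.+1) - g (splice x y k)).
  rewrite -(big_mkord xpredT (fun k => g (splice x y k.+1) - g (splice x y k))).
  rewrite telescope_sumr //; congr (g _ - g _); apply/rowP => j.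
    by rewrite mxE ltn_ord.
  by rewrite mxE ltn0.
rewrite /dotv -sumrB mulr_sumr; apply: le_trans (ler_norm_sum _ _ _) _.
apply: ler_sum => k _.
have line_derive (t : R) : is_derive t 1
    (fun s => g (splice x y k + s *: ebasis R k))
    (partial k g (splice x y k + t *: ebasis R k)).
  by apply: is_derive_line; split; first exact: g_derivable.
have := affine_approx_le (d := (x - y) 0 k) (a := a 0 k) (eps := eps) line_derive.
rewrite spliceS scale0r addr0; apply => t t_le.
by apply: partial_near; exact: splice_segment_eball.
Qed.

Lemma C1_strict_gradient {I : finType} (g : I -> 'rV[R]_n -> R) a (eps : R) :
  (forall i, C1 (g i)) -> 0 < eps -> exists2 r : R, 0 < r &
  forall i x y, eball a r x -> eball a r y ->
    `|g i x - g i y - dotv (grad (g i) a) (x - y)| <= eps * enorm (x - y).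
Proof.
move=> g_C1 eps0; pose eps' := eps / (n%:R + 1).
have n1_gt0 : 0 < n%:R + 1 :> R by rewrite ltr_wpDl.
have eps'_gt0 : 0 < eps' by rewrite divr_gt0.
have : \forall z \near a, forall ij : I * 'I_n,
    `|partial ij.2 (g ij.1) a - partial ij.2 (g ij.1) z| <= eps'.
  apply: (@filter_forall _ _ _ _ (nbhs_filter a)) => -[i j].
  by have [_ /(_ j a)/cvgrPdist_le/(_ _ eps'_gt0)] := g_C1 i.
move=> /nbhs_ballP[r /= r0 partial_near]; exists (r / 4); first by rewrite divr_gt0.
move=> i x y xr yr.
have in_ball z : eball y (enorm (x - y)) z -> ball a r z.
  move=> zy; apply: (@eball_subset_ball _ _ a (r / 4 * 3)); first by lra.
  have := ler_enorm_distD a x y; have := ler_enorm_distD y z a.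
  by rewrite (enorm_distC a) /eball /= in xr yr zy *; lra.
apply: le_trans (partials_approx_le (a := grad (g i) a) (eps := eps') _ _) _.
- by have [] := g_C1 i.
- by move=> j z /in_ball/partial_near/(_ (i, j)); rewrite distrC mxE.
apply: le_trans (ler_wpM2l (ltW eps'_gt0) (sum_normr_coord_le _)) _.
rewrite mulrA ler_wpM2r ?enorm_ge0 // mulrAC ler_pdivrMr //.
by rewrite ler_wpM2l ?(ltW eps0) // lerDl.
Qed.

Lemma is_derive_grad g x v : C1 g -> is_derive x v g (dotv (grad g x) v).
Proof.
move=> g_C1.
have quotient_cvg : (fun h : R => h^-1 *: ((g \o shift x) (h *: v) - g x)) @ 0^' -->
    dotv (grad g x) v.
  have v1_gt0 : 0 < enorm v + 1 by rewrite ltr_wpDl ?enorm_ge0.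
  apply/cvgrPdist_le => e e0.
  have [r r0 g_strict] :=
    C1_strict_gradient (I := 'I_1) x (fun=> g_C1) (divr_gt0 e0 v1_gt0).
  near=> h.
  have h0 : h != 0 by near: h; exact: nbhs_dnbhs_neq.
  have hv : `|h| * enorm v <= r.
    apply: le_trans (_ : `|h| * (enorm v + 1) <= r); first by rewrite ler_wpM2l // lerDl.
    by rewrite -ler_pdivlMr //; near: h; apply: dnbhs0_le; rewrite divr_gt0.
  have := g_strict ord0 (h *: v + x) x; rewrite /eball /= addrK subrr enorm0 enormZ.
  move=> /(_ hv (ltW r0)); rewrite dotvZr => approx.
  rewrite distrC [_ *: _]mulrC.
  have -> : (g (h *: v + x) - g x) / h - dotv (grad g x) v =
      (g (h *: v + x) - g x - h * dotv (grad g x) v) / h by field.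
  rewrite normf_div ler_pdivrMr ?normr_gt0 //; apply: le_trans approx _.
  rewrite mulrCA mulrC ler_wpM2r // mulrAC ler_pdivrMr // ler_wpM2l ?(ltW e0) //.
  by rewrite lerDl.
by split; [apply/cvg_ex; exists (dotv (grad g x) v) | exact: cvg_lim quotient_cvg].
Unshelve. all: by end_near. Qed.

Lemma grad_lipschitz_lower_bound g (L : R) x v : C1 g -> grad_lipschitz g L ->
  g x + dotv (grad g x) v - L / 2 * enorm v ^+ 2 <= g (x + v).
Proof.
move=> g_C1 g_lip; pose c := dotv (grad g x) v.
pose psi (t : R) := g (x + t *: v) + (L / 2 * enorm v ^+ 2 * t ^+ 2 - c * t).
pose dpsi (t : R) := dotv (grad g (x + t *: v)) v + (L * enorm v ^+ 2 * t - c).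
have psi_derive (t : R) : is_derive t 1 psi (dpsi t).
  have g_derive := is_derive_line (is_derive_grad (x + t *: v) v g_C1).
  apply: is_derive_eq.
  by rewrite /dpsi /GRing.scale /=; congr (_ + _); field.
have [|t tI psiE] := MVT_segment (f := psi) ler01 (fun t _ => psi_derive t).
  exact/continuous_subspaceT/is_derive_continuous.
have t0 : 0 <= t by rewrite (itvP tI).
have grad_le : enorm (grad g (x + t *: v) - grad g x) * enorm v <= L * enorm v ^+ 2 * t.
  apply: le_trans (ler_wpM2r (enorm_ge0 _) (g_lip _ _)) _.
  by rewrite (addrC x) addrK enormZ ger0_norm // le_eqVlt; apply/predU1P; left; ring.
have : 0 <= psi 1 - psi 0.
  rewrite psiE subr0 mulr1 /dpsi /c addrCA -dotvBl.
  have := normr_dotv_le (grad g (x + t *: v) - grad g x) v.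
  by rewrite ler_norml => /andP[+ _]; lra.
rewrite /psi scale1r scale0r addr0 /c; lra.
Qed.

End first_order.

Section second_order.
Context {R : realType} {n : nat}.
Variables (f : 'rV[R]_n -> R) (a : 'rV[R]_n).
Hypothesis f_C2 : C2 f.
Implicit Types (x y u w : 'rV[R]_n).

Lemma C2_C1 : C1 f.
Proof. by have [_ [? []]] := f_C2. Qed.

Lemma C2_partial_C1 i : C1 (partial i f).
Proof. by have [_ [_ [_ []]]] := f_C2; split. Qed.

Lemma C2_strict_hessian (eps : R) : 0 < eps -> exists2 r : R, 0 < r &
  forall x y, eball a r x -> eball a r y ->
    enorm (grad f x - grad f y - (x - y) *m (hessian f a)^T) <= eps * enorm (x - y).
Proof.
move=> eps0; have n1_gt0 : 0 < n%:R + 1 :> R by rewrite ltr_wpDl.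
have [r r0 partial_strict] :=
  C1_strict_gradient a C2_partial_C1 (divr_gt0 eps0 n1_gt0).
exists r => // x y xr yr; set e := enorm (x - y).
have coord_le i : `|(grad f x - grad f y - (x - y) *m (hessian f a)^T) 0 i| <=
    eps / (n%:R + 1) * e.
  apply: le_trans (partial_strict i x y xr yr); rewrite !mxE.
  rewrite le_eqVlt; apply/predU1P; left; congr `|_ - _|.
  by apply: eq_bigr => j _; rewrite !mxE mulrC.
apply: le_trans (enorm_le_const coord_le) _; rewrite mulrA ler_wpM2r ?enorm_ge0 //.
by rewrite mulrCA ler_piMr ?(ltW eps0) // ler_pdivrMr // mul1r lerDl.
Qed.

Lemma second_difference_approx u w (eps : R) :
  enorm u <= 1 -> enorm w <= 1 -> 0 < eps -> exists2 r : R, 0 < r &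
  forall s : R, 0 < s -> s <= r ->
    `|f (a + s *: u + s *: w) - f (a + s *: w) - (f (a + s *: u) - f a)
      - s ^+ 2 * dotv (u *m (hessian f a)^T) w| <= eps * s ^+ 2.
Proof.
move=> u1 w1 eps0; have [r r0 grad_strict] := C2_strict_hessian eps0.
exists (r / 2) => [|s s0 sr]; first by rewrite divr_gt0.
pose x t := a + s *: u + t *: w; pose y t := a + t *: w.
have line_derive (t : R) : is_derive t 1 (fun t => f (x t) - f (y t))
    (dotv (grad f (x t)) w - dotv (grad f (y t)) w).
  by apply: is_deriveB; apply: is_derive_line; exact: is_derive_grad C2_C1.
have := affine_approx_le (d := s) (a := s * dotv (u *m (hessian f a)^T) w)
  (eps := eps * s) line_derive.
rewrite /x /y !scale0r !addr0 gtr0_norm // (mulrAC s) -(mulrA eps) -expr2.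
apply=> t ts.
have tw : enorm (t *: w) <= s by rewrite enormZ -[leRHS]mulr1 ler_pM ?enorm_ge0.
have su : enorm (s *: u) <= s.
  by rewrite enormZ gtr0_norm // -[leRHS]mulr1 ler_wpM2l // ltW.
have yr : eball a r (y t) by rewrite /eball /= /y addrAC subrr add0r; lra.
have xr : eball a r (x t).
  rewrite /eball /= /x -[a + _ + _]addrA (addrC a) addrK.
  by apply: le_trans (ler_enormD _ _) _; lra.
have := grad_strict _ _ xr yr.
have -> : x t - y t = s *: u by rewrite /x (addrAC a) (addrC (a + _)) addrK.
rewrite -/(x t) -/(y t) -scalemxAl -dotvZl -!dotvBl => approx.
apply: le_trans (normr_dotv_le _ _) _.
apply: le_trans (ler_pM (enorm_ge0 _) (enorm_ge0 _) approx w1) _.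
by rewrite mulr1 ler_wpM2l // ltW.
Qed.

(* The second difference is symmetric in [u] and [w]. *)
Lemma hessian_sym : (hessian f a)^T = hessian f a.
Proof.
set H := hessian f a.
have dotvH i j : dotv (delta_mx 0 i *m H^T) (delta_mx 0 j) = H j i.
  by rewrite dotv_delta -rowE !mxE.
have delta_le1 i : enorm (delta_mx 0 i : 'rV[R]_n) <= 1 by rewrite enorm_delta.
apply/matrixP => i j; rewrite mxE; apply/eqP; rewrite -subr_eq0 -normr_le0.
apply/ler_addgt0Pr => e e0; rewrite add0r.
have e2_gt0 : 0 < e / 2 by rewrite divr_gt0.
have [r r0 approx_ij] := second_difference_approx (delta_le1 i) (delta_le1 j) e2_gt0.
have [r' r'_gt0 approx_ji] := second_difference_approx (delta_le1 j) (delta_le1 i) e2_gt0.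
pose s := Num.min r r'.
have s0 : 0 < s by rewrite lt_min r0.
have s2 : 0 < s ^+ 2 by rewrite exprn_gt0.
have := approx_ij s s0; have := approx_ji s s0.
rewrite !ge_min !lexx orbT => /(_ isT) + /(_ isT).
rewrite !dotvH [a + s *: delta_mx 0 j + _]addrAC.
set fij := f (a + _ + _); set fi := f (a + _); set fj := f (a + _).
rewrite !ler_norml => /andP[ji_ge ji_le] /andP[ij_ge ij_le].
by apply/andP; split; rewrite -(ler_pM2l s2); lra.
Qed.

Lemma enorm_mul_hessian_le (L : R) v : grad_lipschitz f L ->
  enorm (v *m hessian f a) <= L * enorm v.
Proof.
move=> f_lip; apply/ler_addgt0Pr => e e0; rewrite -{1}hessian_sym.
set Hv := v *m _.
have v1_gt0 : 0 < enorm v + 1 by rewrite ltr_wpDl ?enorm_ge0.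
have [r r0 grad_strict] := C2_strict_hessian (divr_gt0 e0 v1_gt0).
pose t := r / (enorm v + 1); have t0 : 0 < t by rewrite divr_gt0.
have tv : a + t *: v - a = t *: v by rewrite addrAC subrr add0r.
have ar : eball a r a by rewrite /eball /= subrr enorm0 ltW.
have tvr : eball a r (a + t *: v).
  rewrite /eball /= tv enormZ gtr0_norm // mulrAC ler_pdivrMr //.
  by rewrite ler_wpM2l ?(ltW r0) // lerDl.
have := grad_strict _ _ tvr ar; have := f_lip (a + t *: v) a.
rewrite tv -scalemxAl -/Hv !enormZ (gtr0_norm t0); set g := _ - grad f a.
move=> g_le g_approx; rewrite -(ler_pM2l t0) -[in leLHS](gtr0_norm t0) -enormZ.
have -> : t *: Hv = g - (g - t *: Hv) by rewrite subKr.
apply: le_trans (ler_enormB _ _) _; rewrite mulrDr; apply: lerD.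
  by rewrite mulrCA.
apply: le_trans g_approx _; rewrite mulrCA ler_wpM2l ?(ltW t0) //.
by rewrite mulrAC ler_pdivrMr // ler_wpM2l ?(ltW e0) // lerDl.
Qed.

End second_order.

Section coordinate_subsets.
Context {R : realType} {n : nat}.
Variable D : pred 'I_n.
Implicit Types (u v x : 'rV[R]_n).

Definition keep_coords v : 'rV[R]_n := \row_i (v 0 i *+ D i).

Lemma keep_coordsB u v : keep_coords (u - v) = keep_coords u - keep_coords v.
Proof. by apply/rowP => i; rewrite !mxE mulrnBl. Qed.

Lemma enorm_keep_coords v : enorm (keep_coords v) <= enorm v.
Proof. by apply: ler_enorm_coord => i; rewrite mxE; case: (D i); rewrite ?normr0. Qed.

Lemma dotv_keep_coords v : dotv v (keep_coords v) = enorm (keep_coords v) ^+ 2.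
Proof.
rewrite sqr_enorm; apply: eq_bigr => i _; rewrite mxE.
by case: (D i); rewrite // mulr0 mul0r.
Qed.

Definition agree_off x : set 'rV[R]_n := [set y | forall i, ~~ D i -> y 0 i = x 0 i].

Lemma closed_agree_off x : closed (agree_off x).
Proof.
have -> : agree_off x =
    \bigcap_(i in [set i | ~~ D i]) ((fun y => y 0 i) @^-1` [set x 0 i]).
  by apply/seteqP; split => y yx i; [exact: yx | move=> /yx].
apply: closed_bigI => i _; apply: (@preimage_closed 'rV[R]_n R).
  by move=> y _; exact: coord_continuous.
exact: closed_eq.
Qed.

End coordinate_subsets.

Lemma continuous_coercive_min {R : realType} {n : nat} (g : 'rV[R]_n -> R)
    (A : set 'rV[R]_n) a (r : R) :
  continuous g -> closed A -> A a -> 0 <= r ->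
  (forall y, r < enorm (y - a) -> g a <= g y) ->
  exists2 y, A y & forall z, A z -> g y <= g z.
Proof.
move=> g_cont A_closed Aa r0 g_coercive; pose B := A `&` eball a r.
have Ba : B a by split => //; rewrite /eball /= subrr enorm0.
have B_compact : compact B.
  rewrite /B setIC; apply: compact_closedI => //; exact: compact_eball.
have [y /[!inE] -[Ay _] y_min] := EVT_min_rV (ex_intro _ _ Ba) B_compact
  (continuous_subspaceT g_cont).
exists y => // z Az; have [zr|zr] := leP (enorm (z - a)) r.
  by apply: y_min; rewrite inE.
by apply: le_trans (g_coercive z zr); apply: y_min; rewrite inE.
Qed.

Section proximal_step.
Context {R : realType} {n : nat}.
Variables (f : 'rV[R]_n -> R) (L alpha : R).
Hypothesis f_C2 : C2 f.
Hypothesis f_lip : grad_lipschitz f L.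
Hypothesis alpha_gt0 : 0 < alpha.
Hypothesis alphaL_lt1 : alpha * L < 1.
Variable D : pred 'I_n.
Implicit Types (x y z : 'rV[R]_n).

Definition prox x y : R := f y + (2 * alpha)^-1 * enorm (y - x) ^+ 2.

Lemma prox_continuous x : continuous (prox x).
Proof.
have [f_cont _] := f_C2; move=> y.
have enorm_cvg := @enorm_dist_continuous _ _ x y.
apply: (@cvgD _ _ _ _ (nbhs_filter y)); first exact: f_cont.
apply: (@cvgM _ _ _ (nbhs_filter y)); first exact: cvg_cst.
exact: (@cvgM _ _ _ (nbhs_filter y)).
Qed.

Lemma prox_coercive x : exists2 r : R, 0 <= r &
  forall y, r < enorm (y - x) -> prox x x <= prox x y.
Proof.
pose c := (2 * alpha)^-1 - L / 2.
have c0 : 0 < c.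
  have : L < alpha^-1 by rewrite -(ltr_pM2l alpha_gt0) mulfV ?gt_eqF.
  by rewrite /c invfM; lra.
exists (enorm (grad f x) / c) => [|y]; first by rewrite divr_ge0 ?enorm_ge0 // ltW.
rewrite ltr_pdivrMr // => grad_lt.
have : enorm (grad f x) * enorm (y - x) <= c * enorm (y - x) ^+ 2.
  by rewrite expr2 mulrA ler_wpM2r ?enorm_ge0 // mulrC ltW.
have := grad_lipschitz_lower_bound x (y - x) (C2_C1 f_C2) f_lip.
have := normr_dotv_le (grad f x) (y - x); rewrite ler_norml => /andP[dot_ge _].
rewrite /prox subrr enorm0 (addrC x) subrK /c; lra.
Qed.

Lemma prox_min_exists x :
  exists2 y, agree_off D x y & forall z, agree_off D x z -> prox x y <= prox x z.
Proof.
have [r r0 x_coercive] := prox_coercive x.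
have xx : agree_off D x x by [].
exact: continuous_coercive_min (@prox_continuous x) (@closed_agree_off _ _ D x)
  xx r0 x_coercive.
Qed.

Lemma prox_min_stationary x y : agree_off D x y ->
  (forall z, agree_off D x z -> prox x y <= prox x z) ->
  y - x = - alpha *: keep_coords D (grad f y).
Proof.
move=> yx y_min; apply/rowP => i; rewrite [RHS]mxE [in RHS]mxE.
case: (boolP (D i)) => Di; last by rewrite !mxE yx // subrr mulr0.
pose e : 'rV[R]_n := ebasis R i.
pose phi (t : R) := f (y + t *: e) +
  (2 * alpha)^-1 * (enorm (y - x) ^+ 2 + 2 * (y - x) 0 i * t + t ^+ 2).
have phiE t : phi t = prox x (y + t *: e).
  rewrite /phi /prox [y + _ - x]addrAC (sqr_enormD (y - x)) dotvZr dotv_delta.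
  by rewrite enormZ enorm_delta mulr1 real_normK ?num_real //; congr (_ + _ * _); ring.
pose dphi (t : R) := partial i f (y + t *: e) +
  (2 * alpha)^-1 * (2 * (y - x) 0 i + 2 * t).
have phi_derive (t : R) : is_derive t 1 phi (dphi t).
  have [f_derivable _] := C2_C1 f_C2.
  have line_derive : is_derive t 1 (fun s => f (y + s *: e)) (partial i f (y + t *: e)).
    by apply: is_derive_line; split; first exact: f_derivable.
  apply: is_derive_eq.
  by rewrite /dphi /GRing.scale /=; congr (_ + _ * _); ring.
have phi_min : is_derive (0 : R) 1 phi 0.
  apply: (@derive1_at_min _ phi (-1) 1) => [||| t _]; first by lra.
  - by move=> t _; have [] := phi_derive t.
  - by rewrite in_itv /=; apply/andP; split; lra.
  rewrite !phiE scale0r addr0; apply: y_min => j Dj.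
  rewrite !mxE eqxx /= yx //; case: eqVneq => [ji|_]; last by rewrite mulr0 addr0.
  by rewrite ji Di in Dj.
have : dphi 0 = 0.
  by have [_ <-] := phi_derive 0; have [_ ->] := phi_min.
rewrite /dphi scale0r addr0 mulr0 addr0 mulr1n [grad f y 0 i]mxE => /eqP.
by rewrite addr_eq0 => /eqP ->; field; rewrite gt_eqF.
Qed.

Variable T : 'rV[R]_n -> 'rV[R]_n.
Hypothesis T_implicit : forall x, T x - x = - alpha *: keep_coords D (grad f (T x)).

Lemma implicit_stepB x y :
  T x - T y - (x - y) = - alpha *: keep_coords D (grad f (T x) - grad f (T y)).
Proof.
rewrite keep_coordsB scalerBr -!T_implicit.
by apply/rowP => i; rewrite !mxE; ring.
Qed.

Lemma implicit_step_displacement x y :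
  enorm (T x - T y - (x - y)) <= alpha * L * enorm (T x - T y).
Proof.
rewrite implicit_stepB enormZ normrN gtr0_norm // -mulrA ler_wpM2l ?(ltW alpha_gt0) //.
exact: le_trans (enorm_keep_coords _ _) (f_lip _ _).
Qed.

Lemma implicit_step_bilipschitz : 0 <= L -> bilipschitz T.
Proof.
move=> L0; have aL0 : 0 <= alpha * L by rewrite mulr_ge0 // ltW.
have aL1 : 0 < 1 - alpha * L by rewrite subr_gt0.
exists (1 - alpha * L)^-1 => [|x y]; first by rewrite invr_gt0.
have := implicit_step_displacement x y.
set v := x - y; set w := T x - T y => wv_le.
have := ler_enormD v (w - v); have := ler_enormB w (w - v).
rewrite (addrC v) subrK subKr => v_le w_le; rewrite !ler_pdivlMl //.
split; first by lra.
apply: le_trans (_ : (1 - alpha * L) * ((1 + alpha * L) * enorm w) <= _).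
  by rewrite ler_wpM2l ?(ltW aL1) //; lra.
have : 0 <= (alpha * L) ^+ 2 * enorm w by rewrite mulr_ge0 ?sqr_ge0 ?enorm_ge0.
by lra.
Qed.

Lemma implicit_step_critical a : grad f a = 0 -> T a = a.
Proof.
move=> grad0; apply/eqP; rewrite -subr_eq0 -enorm_eq0 eq_le enorm_ge0 andbT.
rewrite -(@pmulr_rle0 _ (1 - alpha * L)) ?subr_gt0 // mulrBl mul1r subr_le0.
rewrite {1}T_implicit enormZ normrN gtr0_norm // -mulrA ler_wpM2l ?(ltW alpha_gt0) //.
apply: le_trans (enorm_keep_coords _ _) _.
by have := f_lip (T a) a; rewrite grad0 subr0.
Qed.

End proximal_step.

Section block_step.
Context {R : realType} {n p : nat}.
Variables (f : 'rV[R]_n -> R) (L alpha : R) (nt : 'I_p -> nat).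
Hypothesis f_C2 : C2 f.
Hypothesis f_lip : grad_lipschitz f L.
Hypothesis alpha_gt0 : 0 < alpha.
Hypothesis alphaL_lt1 : alpha * L < 1.

Lemma block_step_implicit s x : block_step f alpha nt s x - x =
  - alpha *: keep_coords (in_block nt s) (grad f (block_step f alpha nt s x)).
Proof.
have [y yx y_min] := prox_min_exists f_C2 f_lip alpha_gt0 alphaL_lt1 (in_block nt s) x.
have [step_x step_min] : block_argmin f alpha nt s x (block_step f alpha nt s x).
  by apply: xgetPex; exists y.
exact: (prox_min_stationary f_C2 alpha_gt0).
Qed.

End block_step.

Section quad_descent.
Context {R : realType} {n : nat}.
Variables (H : 'M[R]_n) (L : R).
Hypothesis H_le : forall u, enorm (u *m H) <= L * enorm u.
Hypothesis L_ge0 : 0 <= L.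
Implicit Types (u v w g : 'rV[R]_n) (D : pred 'I_n).

(* From [v] to [w] in steps of total length at most [S], which have together moved
   the coordinates in [D], up to an error [eps] relative to the vectors on the way. *)
Definition quad_descent (c C eps : R) D v w (S : R) :=
  [/\ enorm (w - v) <= S,
      quad H w <= quad H v - c * S ^+ 2 + 2 * eps * S * (enorm v + S) &
      forall i, D i -> `|(v *m H) 0 i| <= C * S + eps * (enorm v + S)].

Lemma quad_descent_refl c C eps v : quad_descent c C eps pred0 v v 0.
Proof.
split => //; first by rewrite subrr enorm0.
by rewrite expr0n !mulr0 mul0r subr0 addr0.
Qed.

Lemma quad_descent_trans c1 c2 C eps D1 D2 u v w S1 S2 :
  0 < c1 -> 0 < c2 -> L <= C -> 0 <= eps ->
  quad_descent c1 C eps D1 u v S1 -> quad_descent c2 C eps D2 v w S2 ->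
  quad_descent (Num.min c1 c2 / 2) C eps (predU D1 D2) u w (S1 + S2).
Proof.
move=> c1_gt0 c2_gt0 L_le_C eps0 [uv_le quad_v D1_le] [vw_le quad_w D2_le].
have S1_ge0 : 0 <= S1 by apply: le_trans uv_le; exact: enorm_ge0.
have S2_ge0 : 0 <= S2 by apply: le_trans vw_le; exact: enorm_ge0.
have v_le : enorm v <= enorm u + S1.
  by have := ler_enormD (v - u) u; rewrite subrK addrC; lra.
have [epsS1_ge0 epsS2_ge0] : 0 <= eps * S1 /\ 0 <= eps * S2 by split; exact: mulr_ge0.
split.
- have := ler_enorm_distD v w u; lra.
- have S1_decrease : Num.min c1 c2 * S1 ^+ 2 <= c1 * S1 ^+ 2.
    by rewrite ler_wpM2r ?sqr_ge0 // ge_min lexx.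
  have S2_decrease : Num.min c1 c2 * S2 ^+ 2 <= c2 * S2 ^+ 2.
    by rewrite ler_wpM2r ?sqr_ge0 // ge_min lexx orbT.
  have parallelogram : 0 <= Num.min c1 c2 * (S1 - S2) ^+ 2.
    by rewrite mulr_ge0 ?sqr_ge0 // le_min !ltW.
  have S2_error : eps * S2 * enorm v <= eps * S2 * (enorm u + S1).
    by rewrite ler_wpM2l.
  have epsS1S2_ge0 : 0 <= eps * S1 * S2 by rewrite mulr_ge0.
  lra.
have C0 : 0 <= C by apply: le_trans L_le_C.
move=> i /orP[D1i|D2i].
  have CS2_ge0 : 0 <= C * S2 by rewrite mulr_ge0.
  by have := D1_le i D1i; lra.
have uvH_le : `|((v - u) *m H) 0 i| <= C * S1.
  apply: le_trans (normr_coord_le_enorm _ i) _; apply: le_trans (H_le _) _.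
  by rewrite ler_pM ?enorm_ge0.
have eps_v_le : eps * enorm v <= eps * (enorm u + S1) by rewrite ler_wpM2l.
have -> : (u *m H) 0 i = (v *m H) 0 i - ((v - u) *m H) 0 i.
  by rewrite mulmxBl !mxE; ring.
have := D2_le i D2i; have := ler_normB ((v *m H) 0 i) (((v - u) *m H) 0 i); lra.
Qed.

(* [g] is the difference of the gradients at the new points, which is [w *m H] for a
   quadratic function. *)
Lemma implicit_step_quad_descent (alpha eps : R) D v w g :
  H^T = H -> 0 < alpha -> alpha * L < 1 -> 0 <= eps ->
  w - v = - alpha *: keep_coords D g -> enorm (g - w *m H) <= eps * enorm w ->
  quad_descent alpha^-1 (alpha^-1 + L) eps D v w (enorm (w - v)).
Proof.
move=> symH alpha0 aL eps0 wvE g_le; pose e := w - v; pose d := g - w *m H.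
have alphaV0 : 0 < alpha^-1 by rewrite invr_gt0.
have L_le_alphaV : L <= alpha^-1 by rewrite -(ler_pM2l alpha0) mulfV ?gt_eqF // ltW.
have e_sqr : dotv g e = - (alpha^-1 * enorm e ^+ 2).
  rewrite /e wvE dotvZr dotv_keep_coords enormZ normrN gtr0_norm // exprMn.
  by field; rewrite gt_eqF.
have w_le : enorm w <= enorm v + enorm e.
  by have := ler_enormD v e; rewrite {1}/e (addrC v) subrK.
have wH : w *m H = g - d by rewrite /d subKr.
have vE : v = w - e by rewrite /e subKr.
rewrite -/e; split=> // [|i Di].
- have := quadB_sym w e symH; rewrite -vE wH dotvBl e_sqr.
  have := normr_quad_le e H_le; have := normr_dotv_le d e.
  rewrite !ler_norml => /andP[de_ge _] /andP[He_ge _].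
  have Le_le : L * enorm e ^+ 2 <= alpha^-1 * enorm e ^+ 2.
    by rewrite ler_wpM2r ?sqr_ge0.
  have de_le : enorm d * enorm e <= eps * enorm w * enorm e.
    by rewrite ler_wpM2r ?enorm_ge0.
  have we_le : eps * enorm e * enorm w <= eps * enorm e * (enorm v + enorm e).
    by rewrite ler_wpM2l // mulr_ge0 ?enorm_ge0.
  lra.
- have e_i : e 0 i = - alpha * g 0 i by rewrite /e wvE !mxE Di.
  have -> : (v *m H) 0 i = - (alpha^-1 * e 0 i) - d 0 i - (e *m H) 0 i.
    by rewrite vE mulmxBl wH e_i !mxE; field; rewrite gt_eqF.
  apply: le_trans (ler_normB _ _) _.
  apply: le_trans (lerD (ler_normB _ _) (normr_coord_le_enorm _ i)) _.
  rewrite normrN normrM (gtr0_norm alphaV0).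
  have := ler_wpM2l (ltW alphaV0) (normr_coord_le_enorm e i).
  have := normr_coord_le_enorm d i; have := H_le e; have := ler_wpM2l eps0 w_le.
  rewrite -/d in g_le; lra.
Qed.

Lemma quad_descent_cone_displacement K c C eps tau v w S :
  (forall u, `|quad H u| <= (K * enorm (u *m H)) ^+ 2) -> 0 <= K -> 0 <= tau ->
  eps <= 1 -> 2 * K * n%:R * eps <= tau ->
  quad_descent c C eps predT v w S -> quad (H + (tau ^+ 2)%:M) v <= 0 ->
  tau * enorm v <= 2 * K * n%:R * (C + 1) * S.
Proof.
move=> H_ge K0 tau_ge0 eps_le1 eps_small [wv_le _ vH_le].
rewrite quad_add_scalar => v_cone.
have S0 : 0 <= S by apply: le_trans wv_le; exact: enorm_ge0.
have Kn0 : 0 <= K * n%:R by rewrite mulr_ge0.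
have tau_le : tau * enorm v <= K * enorm (v *m H).
  rewrite -(@ler_pXn2r _ 2) ?nnegrE ?mulr_ge0 ?enorm_ge0 // exprMn.
  by apply: le_trans (H_ge v); have := ler_norm (- quad H v); rewrite normrN; lra.
have vH_norm_le : enorm (v *m H) <= n%:R * (C * S + eps * (enorm v + S)).
  by apply: enorm_le_const => i; exact: vH_le.
have tau_v_le := le_trans tau_le (ler_wpM2l K0 vH_norm_le).
have eps_S_le : K * n%:R * (eps * S) <= K * n%:R * S.
  by rewrite ler_wpM2l // -[leRHS]mul1r ler_wpM2r.
have eps_v_le := ler_wpM2r (enorm_ge0 v) eps_small.
lra.
Qed.

(* In the cone the displacement [S] is at least of order [tau * enorm v], so that the
   decrease [c * S ^+ 2] of the form outweighs the error terms. *)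
Lemma quad_descent_cone c C : H^T = H -> 0 < c -> 0 <= C ->
  exists2 tau0 : R, 0 < tau0 & forall tau, 0 < tau -> tau <= tau0 ->
  exists2 eps : R, 0 < eps & forall v w S, quad_descent c C eps predT v w S ->
    quad (H + (tau ^+ 2)%:M) v <= 0 ->
    quad (H + (tau ^+ 2)%:M) w <= quad (H + (tau ^+ 2)%:M) v.
Proof.
move=> symH c0 C0; have [k k0 H_ge] := symmetric_quad_le_sqr symH.
pose kn := 2 * k * n%:R; have kn0 : 0 <= kn by rewrite !mulr_ge0 // ltW.
pose M := kn * (C + 1); have M0 : 0 <= M by rewrite mulr_ge0 // addr_ge0.
have M3_gt0 : 0 < 4 * M + 3 by lra.
exists (Num.min 1 (c / (4 * M + 3))); first by rewrite lt_min ltr01 divr_gt0.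
move=> tau tau_gt0; rewrite le_min ler_pdivlMr // => /andP[tau_le1 tau_c].
have kn1_gt0 : 0 < kn + 1 by lra.
have tau_sqr_le : tau ^+ 2 <= tau by rewrite expr2 ler_piMr // ltW.
exists (Num.min (tau ^+ 2) (tau / (kn + 1))).
  by rewrite lt_min exprn_gt0 // divr_gt0.
set eps := Num.min _ _ => v w S descent v_cone.
have eps_tau2 : eps <= tau ^+ 2 by rewrite ge_min lexx.
have eps0 : 0 < eps by rewrite lt_min exprn_gt0 // divr_gt0.
have kn_eps : kn * eps <= tau.
  have : eps * (kn + 1) <= tau by rewrite -ler_pdivlMr // ge_min lexx orbT.
  lra.
have [wv_le quad_w _] := descent.
have S0 : 0 <= S by apply: le_trans wv_le; exact: enorm_ge0.
have v0 := enorm_ge0 v.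
have tau_v : tau * enorm v <= M * S.
  apply: quad_descent_cone_displacement H_ge _ _ _ kn_eps descent v_cone; last by lra.
    exact: ltW.
  exact: ltW.
have w_sqr : enorm w ^+ 2 <= (enorm v + S) ^+ 2.
  rewrite ler_pXn2r ?nnegrE ?addr_ge0 ?enorm_ge0 //.
  by have := ler_enormD v (w - v); rewrite (addrC v) subrK; lra.
have tau2_w_le := ler_wpM2l (sqr_ge0 tau) w_sqr.
have error_le : eps * (S * (enorm v + S)) <= tau ^+ 2 * (S * (enorm v + S)).
  by rewrite ler_wpM2r // mulr_ge0 // addr_ge0.
have cross_le : tau * S * (tau * enorm v) <= tau * S * (M * S).
  by rewrite ler_wpM2l // mulr_ge0 // ltW.
have tau2_S_le : tau ^+ 2 * S ^+ 2 <= tau * S ^+ 2 by rewrite ler_wpM2r ?sqr_ge0.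
have decrease_ge : tau * (4 * M + 3) * S ^+ 2 <= c * S ^+ 2.
  by rewrite ler_wpM2r ?sqr_ge0.
by rewrite !quad_add_scalar; lra.
Qed.

End quad_descent.

Section local_quad_descent.
Context {R : realType} {n : nat}.
Variables (H : 'M[R]_n) (L C : R) (a : 'rV[R]_n).
Hypothesis H_le : forall u, enorm (u *m H) <= L * enorm u.
Hypothesis L_ge0 : 0 <= L.
Hypothesis L_le : L <= C.
Implicit Types (D : pred 'I_n) (T : 'rV[R]_n -> 'rV[R]_n).

Definition local_quad_descent (c : R) D T := forall eps : R, 0 < eps ->
  exists2 r : R, 0 < r & forall x y, eball a r x -> eball a r y ->
    exists S, quad_descent H c C eps D (x - y) (T x - T y) S.

Lemma local_quad_descent_comp c1 c2 D1 D2 T U : 0 < c1 -> 0 < c2 ->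
  bilipschitz T -> T a = a ->
  local_quad_descent c1 D1 T -> local_quad_descent c2 D2 U ->
  local_quad_descent (Num.min c1 c2 / 2) (predU D1 D2) (U \o T).
Proof.
move=> c1_gt0 c2_gt0 T_bilip Ta T_descent U_descent eps eps0.
have [r1 r1_gt0 T_near] := T_descent eps eps0.
have [r2 r2_gt0 U_near] := U_descent eps eps0.
have [r3 r3_gt0 T_eball] := bilipschitz_fixpoint_eball T_bilip Ta r2_gt0.
exists (Num.min r1 r3) => [|x y]; first by rewrite lt_min r1_gt0.
rewrite /eball /= !le_min => /andP[xr1 /T_eball xr2] /andP[yr1 /T_eball yr2].
have [S1 xy_descent] := T_near x y xr1 yr1.
have [S2 Txy_descent] := U_near _ _ xr2 yr2.
by exists (S1 + S2); apply: quad_descent_trans Txy_descent => //; exact: ltW.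
Qed.

Lemma local_quad_descent_foldl {I : Type} (F : I -> 'rV[R]_n -> 'rV[R]_n)
    (D : I -> pred 'I_n) (c : R) (s : seq I) :
  0 < c -> (forall i, bilipschitz (F i)) -> (forall i, F i a = a) ->
  (forall i, local_quad_descent c (D i) (F i)) ->
  exists2 c' : R, 0 < c' & local_quad_descent c'
    [pred j | has (fun i => D i j) s] (foldl (fun x i => F i x) ^~ s).
Proof.
move=> c0 F_bilip Fa F_descent; elim: s => [|i s [c' c'_gt0 s_descent]].
  exists 1 => // eps _; exists 1 => // x y _ _.
  by exists 0; exact: quad_descent_refl.
exists (Num.min c c' / 2); first by rewrite divr_gt0 // lt_min c0.
exact: (local_quad_descent_comp c0 c'_gt0 (F_bilip i) (Fa i) (F_descent i) s_descent).
Qed.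

End local_quad_descent.

Lemma in_block_cover (n p : nat) (nt : 'I_p -> nat) (i : 'I_n) :
  (\sum_(t < p) nt t)%N = n -> exists s, in_block nt s i.
Proof.
move=> sum_nt; pose covered k := (i < \sum_(t < p | (t <= k)%N) nt t)%N.
have all_covered k : (p <= k.+1)%N -> covered k.
  move=> pk; rewrite /covered (eq_bigl xpredT) ?sum_nt // => t.
  by rewrite -ltnS (leq_trans (ltn_ord t)).
have [k k_covered k_min] := ex_minnP (ex_intro covered p (all_covered p (leqnSn p))).
have kp : (k < p)%N.
  have [//|pk] := ltnP k p; case: k pk k_covered k_min => [|k] pk k_covered k_min.
    by move: k_covered; rewrite /covered big1 // => t; have := leq_trans (ltn_ord t) pk.
  by have := k_min k (all_covered k pk); rewrite ltnn.
exists (Ordinal kp); apply/andP; split; last exact: k_covered.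
rewrite /=; case: k {kp k_covered} k_min => [|k] k_min; first by rewrite big1.
by rewrite leqNgt; apply/negP => /k_min; rewrite ltnn.
Qed.

Section pbcd_sweep.
Context {R : realType} {n p : nat}.
Variables (f : 'rV[R]_n -> R) (L alpha : R) (nt : 'I_p -> nat).
Hypothesis f_C2 : C2 f.
Hypothesis f_lip : grad_lipschitz f L.
Hypothesis L_ge0 : 0 <= L.
Hypothesis alpha_gt0 : 0 < alpha.
Hypothesis alphaL_lt1 : alpha * L < 1.

Lemma block_step_bilipschitz s : bilipschitz (block_step f alpha nt s).
Proof.
apply: (implicit_step_bilipschitz f_lip alpha_gt0 alphaL_lt1) => //.
exact: (block_step_implicit nt f_C2 f_lip alpha_gt0 alphaL_lt1 s).
Qed.

Lemma pbcd_sweep_bilipschitz : bilipschitz (pbcd_sweep f alpha nt).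
Proof. exact/bilipschitz_foldl/block_step_bilipschitz. Qed.

Variable a : 'rV[R]_n.
Hypothesis grad_a : grad f a = 0.

Lemma block_step_critical s : block_step f alpha nt s a = a.
Proof.
apply: (implicit_step_critical f_lip alpha_gt0 alphaL_lt1) grad_a.
exact: (block_step_implicit nt f_C2 f_lip alpha_gt0 alphaL_lt1 s).
Qed.

Lemma block_step_local_quad_descent s : local_quad_descent (hessian f a)
  (alpha^-1 + L) a alpha^-1 (in_block nt s) (block_step f alpha nt s).
Proof.
move=> eps eps0; have [r r0 grad_strict] := C2_strict_hessian a f_C2 eps0.
have [r' r'_gt0 step_eball] :=
  bilipschitz_fixpoint_eball (block_step_bilipschitz s) (block_step_critical s) r0.
exists r' => // x y /step_eball xr /step_eball yr.
exists (enorm (block_step f alpha nt s x - block_step f alpha nt s y - (x - y))).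
apply: implicit_step_quad_descent => //.
- by move=> u; exact: enorm_mul_hessian_le.
- exact: hessian_sym.
- exact: ltW.
- exact/implicit_stepB/(block_step_implicit nt f_C2 f_lip alpha_gt0 alphaL_lt1 s).
- by have := grad_strict _ _ xr yr; rewrite hessian_sym.
Qed.

Lemma pbcd_sweep_local_quad_descent : (\sum_(t < p) nt t)%N = n ->
  exists2 c : R, 0 < c & local_quad_descent (hessian f a)
    (alpha^-1 + L) a c predT (pbcd_sweep f alpha nt).
Proof.
move=> sum_nt; have alphaV0 : 0 < alpha^-1 by rewrite invr_gt0.
have H_le u := enorm_mul_hessian_le a f_C2 u f_lip.
have [|c c0 sweep_descent] := local_quad_descent_foldl H_le L_ge0 _ (enum 'I_p) alphaV0
  block_step_bilipschitz block_step_critical block_step_local_quad_descent.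
  by rewrite lerDr ltW.
exists c => // eps /sweep_descent[r r0 near_a]; exists r => // x y xr yr.
have [S [displacement quad_le coord_le]] := near_a x y xr yr.
exists S; split=> // i _; apply: coord_le; apply/hasP.
by have [s si] := in_block_cover i sum_nt; exists s; rewrite ?mem_enum.
Qed.

(* [S] is the Hessian plus a multiple of the identity too small to compensate [lam]. *)
Lemma pbcd_sweep_cone (lam : R) : (\sum_(t < p) nt t)%N = n ->
  eigenvalue (hessian f a) lam -> lam < 0 ->
  exists (S : 'M[R]_n) w (r : R), [/\ quad S w < 0, 0 < r &
    forall x y, eball a r x -> eball a r y -> quad S (x - y) <= 0 ->
      quad S (pbcd_sweep f alpha nt x - pbcd_sweep f alpha nt y) <= quad S (x - y)].
Proof.
move=> sum_nt /eigenvalueP[w wH w_neq0] lam0.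
have [c c0 sweep_descent] := pbcd_sweep_local_quad_descent sum_nt.
have C0 : 0 <= alpha^-1 + L by rewrite addr_ge0 ?invr_ge0 // ltW.
have [tau0 tau0_gt0 cone] := quad_descent_cone (hessian_sym a f_C2) c0 C0.
pose tau : R := Num.min tau0 (Num.min 1 (- lam / 2)).
have tau_gt0 : 0 < tau by rewrite !lt_min tau0_gt0 ltr01 /= divr_gt0 // oppr_gt0.
have tau_lam : tau ^+ 2 < - lam.
  have tau_le1 : tau <= 1 by rewrite !ge_min lexx orbT.
  have tau_le : tau <= - lam / 2 by rewrite !ge_min lexx !orbT.
  have tau_sqr_le : tau ^+ 2 <= tau by rewrite expr2 ler_piMr // ltW.
  lra.
have [|eps eps0 eps_cone] := cone tau tau_gt0; first by rewrite ge_min lexx.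
have [r r0 near_a] := sweep_descent eps eps0.
exists (hessian f a + (tau ^+ 2)%:M), w, r; split => // [|x y xr yr].
- rewrite quad_add_scalar /quad wH dotvZl -sqr_enorm -mulrDl pmulr_llt0; first by lra.
  by rewrite exprn_gt0 // enorm_gt0.
- by have [S descent] := near_a x y xr yr; exact: eps_cone descent.
Qed.

End pbcd_sweep.

Lemma interval_cells {R : archiRealFieldType} (B : R) (N : nat) : 0 < B ->
  exists cell : R -> 'I_N.+1, forall s t, `|s| < B -> `|t| < B ->
    cell s = cell t -> `|s - t| <= 2 * B / N.+1%:R.
Proof.
move=> B0; have N0 : 0 < N.+1%:R :> R by rewrite ltr0n.
have B2 : 0 < 2 * B by rewrite mulr_gt0.
pose scale s := (s + B) * N.+1%:R / (2 * B).
exists (fun s => inord (Num.truncn (scale s))) => s t sB tB /(congr1 val) /=.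
have scale_ge0 u : `|u| < B -> 0 <= scale u.
  by rewrite ltr_norml => /andP[u_gt _]; rewrite divr_ge0 ?mulr_ge0 ?(ltW B2) //; lra.
have truncn_lt u : `|u| < B -> (Num.truncn (scale u) < N.+1)%N.
  move=> uB; rewrite -(ltr_nat R); apply: le_lt_trans (_ : scale u < _).
    by rewrite truncn_le scale_ge0.
  rewrite ltr_pdivrMr // mulrC ltr_pM2l //.
  by move: uB; rewrite ltr_norml => /andP[_]; lra.
rewrite !inordK ?truncn_lt // => same_cell.
have := truncn_itv (scale_ge0 _ sB); have := truncn_itv (scale_ge0 _ tB).
rewrite same_cell -natr1 => /andP[t_ge t_lt] /andP[s_ge s_lt].
have : `|scale s - scale t| <= 1 by rewrite ler_norml; apply/andP; split; lra.
have -> : scale s - scale t = (s - t) * (N.+1%:R / (2 * B)).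
  by rewrite /scale; field; rewrite gt_eqF.
rewrite normrM (@gtr0_norm _ (_ / _)) ?divr_gt0 //.
by rewrite -ler_pdivlMr ?divr_gt0 // invf_div mul1r.
Qed.

Section jordan_null.
Context {R : realType} {n : nat}.
Implicit Types (u v w x y c : 'rV[R]_n) (A : set 'rV[R]_n).

Definition jordan_null A := forall eps : R, 0 < eps ->
  exists (centers : seq 'rV[R]_n) (h : R),
    [/\ 0 <= h, (size centers)%:R * h ^+ n <= eps &
        forall x, A x -> exists2 c, c \in centers & eball c h x].

Lemma jordan_null_preimage T A :
  bilipschitz T -> jordan_null A -> jordan_null (T @^-1` A).
Proof.
move=> [K K0 T_bilip] A_null eps eps0.
have K2 : 0 < (2 * K) ^+ n by rewrite exprn_gt0 // mulr_gt0.
have [cs [h [h0 cs_le A_cover]]] := A_null _ (divr_gt0 eps0 K2).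
exists [seq xget 0 (T @^-1` eball c h) | c <- cs], (2 * K * h); split.
- by rewrite !mulr_ge0 // ltW.
- by rewrite size_map exprMn mulrCA mulrC -ler_pdivlMr.
move=> x /A_cover[c c_cs xc]; set y := xget 0 (T @^-1` eball c h).
have yc : eball c h (T y) by apply: (@xgetPex _ 0 (T @^-1` eball c h)); exists x.
exists y; first exact: map_f.
have [_] := T_bilip x y; rewrite /eball /=; move/le_trans; apply.
rewrite (mulrC 2) -mulrA ler_wpM2l ?(ltW K0) //.
apply: le_trans (ler_enorm_distD c _ _) _; rewrite (enorm_distC c).
by rewrite /eball /= in xc yc; lra.
Qed.

(* A set with [m] Lipschitz coordinates is covered by [N ^ m] balls of radius [O(1/N)]. *)
Lemma lipschitz_chart_jordan_null {m : nat} (phi : 'rV[R]_n -> 'rV[R]_m) (B C : R) A :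
  (m < n)%N -> 0 <= C -> (forall x, A x -> enorm (phi x) < B) ->
  (forall x y, A x -> A y -> enorm (x - y) <= C * enorm (phi x - phi y)) ->
  jordan_null A.
Proof.
move=> mn C0 phi_lt phi_ge eps eps0.
have [->|/set0P[a Aa]] := eqVneq A set0.
  by exists [::], 0; split => [||x []] //; rewrite mul0r ltW.
have B0 : 0 < B by apply: le_lt_trans (enorm_ge0 _) (phi_lt a Aa).
pose h := C * (m%:R * (2 * B)); have h0 : 0 <= h by rewrite !mulr_ge0 // ltW.
pose N := Num.truncn (h ^+ n / eps); have N0 : 0 < N.+1%:R :> R by rewrite ltr0n.
have [cell cell_le] := interval_cells N B0.
pose code x := [ffun j => cell (phi x 0 j)].
exists [seq xget 0 (A `&` (code @^-1` [set k])) | k <- enum {ffun 'I_m -> 'I_N.+1}],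
  (h / N.+1%:R); split.
- by rewrite divr_ge0 // ltW.
- rewrite size_map -cardE card_ffun !card_ord natrX expr_div_n mulrA.
  rewrite ler_pdivrMr ?exprn_gt0 // mulrC.
  have hN : h ^+ n <= eps * N.+1%:R.
    by rewrite mulrC -ler_pdivrMr // ltW // truncnS_gt.
  apply: le_trans (ler_wpM2r (exprn_ge0 _ (ltW N0)) hN) _.
  rewrite -mulrA -exprS ler_wpM2l ?(ltW eps0) //.
  by rewrite ler_weXn2l // ler1n.
move=> x Ax; set y := xget 0 (A `&` (code @^-1` [set code x])).
have [Ay codeE] : (A `&` (code @^-1` [set code x])) y.
  by apply: xgetPex; exists x.
exists y; first by apply: map_f; rewrite mem_enum.
apply: le_trans (phi_ge x y Ax Ay) _; rewrite -!mulrA ler_wpM2l //.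
rewrite (mulrA 2); apply: enorm_le_const => j; rewrite !mxE.
have phi_j_lt z : A z -> `|phi z 0 j| < B.
  by move=> /phi_lt; apply: le_lt_trans; exact: normr_coord_le_enorm.
apply: cell_le; [exact: phi_j_lt | exact: phi_j_lt |].
by move/ffunP/(_ j): codeE; rewrite !ffunE.
Qed.

Lemma quad_ge0_coef_le (A : 'M[R]_n) w : quad A w < 0 -> exists2 C : R, 0 <= C &
  forall t u, 0 <= quad A (t *: w + u) -> `|t| <= C * enorm u.
Proof.
move=> w_neg; have [K K0 A_le] := enorm_mulmx_bounded A.
pose c := 2 * K * enorm w + K; pose kappa := - quad A w.
have kappa0 : 0 < kappa by rewrite oppr_gt0.
have c0 : 0 <= c by rewrite addr_ge0 ?mulr_ge0 ?enorm_ge0.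
have ck0 : 0 <= c / kappa by rewrite divr_ge0 // ltW.
exists (c / kappa + 1) => [|t u tu_ge0]; first by rewrite addr_ge0.
have u0 := enorm_ge0 u; have t0 := normr_ge0 t.
rewrite leNgt; apply/negP => t_gt.
have ut : enorm u <= `|t|.
  by apply: le_trans (ltW t_gt); rewrite -[leLHS]mul1r ler_wpM2r // lerDr.
have t_gt0 : 0 < `|t| by apply: le_lt_trans t_gt; rewrite mulr_ge0 // addr_ge0.
have cross_le v z : `|dotv (v *m A) z| <= K * enorm v * enorm z.
  by apply: le_trans (normr_dotv_le _ _) _; rewrite ler_wpM2r ?enorm_ge0.
have : kappa * `|t| ^+ 2 <= c * enorm u * `|t|.
  move: tu_ge0; rewrite quadD quadZ -scalemxAl dotvZl dotvZr.
  rewrite real_normK ?num_real //.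
  have linear_le : t * (dotv (w *m A) u + dotv (u *m A) w) <=
      `|t| * (2 * (K * enorm w * enorm u)).
    apply: le_trans (ler_norm _) _; rewrite normrM ler_wpM2l //.
    apply: le_trans (ler_normD _ _) _.
    by have := cross_le w u; have := cross_le u w; lra.
  have u_quad_le : quad A u <= K * enorm u * `|t|.
    apply: le_trans (ler_norm _) (le_trans (cross_le u u) _).
    by rewrite ler_wpM2l ?mulr_ge0.
  by rewrite /kappa /c; lra.
rewrite expr2 mulrA ler_pM2r // -ler_pdivlMl // => t_le.
move: t_gt; rewrite ltNge => /negP; apply; apply: le_trans t_le _.
by rewrite mulrA (mulrC _ c) ler_wpM2r // lerDl.
Qed.

Lemma enorm_col' (i : 'I_n) u : u 0 i = 0 -> enorm (col' i u) = enorm u.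
Proof.
move=> u_i; congr Num.sqrt; rewrite [RHS](bigD1_ord i) //= u_i expr0n add0r.
by apply: eq_bigr => j _; rewrite mxE.
Qed.

(* [A] is a Lipschitz graph over a coordinate hyperplane transverse to [w]. *)
Lemma cone_free_jordan_null (S : 'M[R]_n) w (B : R) A : quad S w < 0 ->
  (forall x, A x -> enorm x <= B) ->
  (forall x y, A x -> A y -> 0 <= quad S (x - y)) -> jordan_null A.
Proof.
move=> w_neg A_le A_cone.
have [i w_i] : exists i, w 0 i != 0.
  apply/existsP; apply: contraLR w_neg => /existsPn w0.
  have -> : w = 0 by apply/rowP => j; rewrite mxE; apply/eqP; rewrite -[_ == _]negbK w0.
  by rewrite /quad dotv0r ltxx.
have [C C0 C_ge] := quad_ge0_coef_le w_neg.
pose slope x := x 0 i / w 0 i; pose phi x := x - slope x *: w.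
have phi_i x : phi x 0 i = 0 by rewrite !mxE divfK // subrr.
have phiB x y : phi (x - y) = phi x - phi y.
  by apply/rowP => j; rewrite /phi /slope !mxE; field.
have n_gt0 : (0 < n)%N by apply: leq_ltn_trans (ltn_ord i).
apply: (@lipschitz_chart_jordan_null n.-1 (fun x => col' i (phi x))
  (`|B| + `|B| / `|w 0 i| * enorm w + 1) (C * enorm w + 1)).
- by rewrite ltn_predL.
- by rewrite addr_ge0 // mulr_ge0 ?enorm_ge0.
- move=> x /A_le x_le; have {}x_le : enorm x <= `|B| by rewrite (le_trans x_le) ?ler_norm.
  rewrite enorm_col' // ltr_pwDr //.
  apply: le_trans (ler_enormB _ _) _; apply: lerD => //.
  rewrite enormZ ler_wpM2r ?enorm_ge0 // normf_div ler_wpM2r ?invr_ge0 //.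
  exact: le_trans (normr_coord_le_enorm _ _) x_le.
move=> x y Ax Ay.
have -> : col' i (phi x) - col' i (phi y) = col' i (phi (x - y)).
  by rewrite phiB; apply/rowP => j; rewrite !mxE.
rewrite enorm_col' //; set d := x - y.
have dE : d = slope d *: w + phi d by rewrite addrC subrK.
rewrite [in leLHS]dE; apply: le_trans (ler_enormD _ _) _; rewrite enormZ.
have := ler_wpM2r (enorm_ge0 w) (C_ge (slope d) (phi d) _); rewrite -dE.
by move=> /(_ (A_cone x y Ax Ay)); lra.
Qed.

End jordan_null.

Section tuple_measurability.
Context {R : realType} {n : nat}.
Implicit Types (U : set 'rV[R]_n).

Lemma exists_rational_ball (x : 'rV[R]_n) (e : R) : 0 < e ->
  exists q : 'rV[rat]_n, ball (map_mx ratr q : 'rV[R]_n) e x.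
Proof.
move=> e0.
have /choice[q q_near] (i : 'I_n) : exists q : rat, ball (ratr q : R) e (x 0 i).
  have itv_gt0 : x 0 i - e < x 0 i + e by lra.
  have [q] := rat_in_itvoo itv_gt0; rewrite in_itv /= => /andP[q_gt q_lt].
  by exists q; rewrite /ball /= ltr_norml; apply/andP; split; lra.
exists (\row_i q i); split => // i j.
by rewrite !mxE (ord1 i); exact: q_near.
Qed.

Lemma measurable_preimage_ball (c : 'rV[R]_n) (e : R) : 0 < e ->
  measurable (@tuple_to_row R n @^-1` ball c e).
Proof.
move=> e0; have -> : @tuple_to_row R n @^-1` ball c e =
    \bigcap_(i : 'I_n) ((fun t : n.-tuple R => tnth t i) @^-1` ball (c 0 i) e).
  apply/seteqP; split => [t [_ tc] i _ | t tc].
    by have := tc 0 i; rewrite mxE.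
  by split => // i j; rewrite (ord1 i) mxE; exact: tc.
apply: fin_bigcap_measurable => [|i _]; first exact: finite_finset.
rewrite -[X in measurable X]setTI; apply: measurable_tnth => //.
by rewrite ball_itv; exact: measurable_itv.
Qed.

Lemma measurable_preimage_open U : open U -> measurable (@tuple_to_row R n @^-1` U).
Proof.
move=> U_open.
pose rball (qm : 'rV[rat]_n * nat) : set 'rV[R]_n :=
  ball (map_mx ratr qm.1 : 'rV[R]_n) qm.2.+1%:R^-1.
have -> : U = \bigcup_(qm in [set qm | rball qm `<=` U]) rball qm.
  apply/seteqP; split => [x Ux | x [qm /= sub_U /sub_U //]].
  have /nbhs_ballP[r /= r0 r_sub] : nbhs x U by apply: open_nbhs_nbhs.
  pose m := Num.truncn (2 / r).
  have m_lt : m.+1%:R^-1 * 2 < r.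
    by rewrite mulrC ltr_pdivrMr // mulrC -ltr_pdivrMr // truncnS_gt.
  have m0 : 0 < m.+1%:R^-1 :> R by rewrite invr_gt0.
  have [q xq] := exists_rational_ball x m0.
  exists (q, m) => //= y qy; apply: r_sub; apply: le_ball (ltW m_lt) _ _.
  by rewrite mulr_natr mulr2n; apply: ball_triangle qy; exact: ball_sym.
rewrite preimage_bigcup bigcup_mkcond; apply: countable_bigcupT_measurable => // qm.
case: ifP => // _; apply: measurable_preimage_ball; by rewrite invr_gt0.
Qed.

Lemma continuous_measurable_tuple (g : 'rV[R]_n -> R) :
  continuous g -> measurable_fun setT (g \o @tuple_to_row R n).
Proof.
move=> /continuousP g_cont; apply: (measurability _ (RGenOpens.measurableE R)).
move=> /= _ [U [a [b ->]]] <-; rewrite setTI comp_preimage.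
by apply: measurable_preimage_open; apply: g_cont; exact: interval_open.
Qed.

Lemma measurable_cvg_tuple (u : nat -> 'rV[R]_n -> 'rV[R]_n) (l : 'rV[R]_n) :
  (forall k, continuous (u k)) ->
  measurable [set t : n.-tuple R | u k (tuple_to_row t) @[k --> \oo] --> l].
Proof.
move=> u_cont.
pose dist k (t : n.-tuple R) : \bar R := (enorm (u k (tuple_to_row t) - l))%:E.
have dist_measurable k : measurable_fun setT (dist k).
  apply/measurable_EFinP.
  apply: (continuous_measurable_tuple (g := fun x => enorm (u k x - l))) => x.
  apply: (@cvg_enorm _ _ _ _ (nbhs_filter x)).
  by apply: (@cvgB _ _ _ _ (nbhs_filter x)); [exact: u_cont | exact: cvg_cst].
have -> : [set t | u k (tuple_to_row t) @[k --> \oo] --> l] =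
    setT `&` [set t | (limn_esup (dist ^~ t) <= 0)%E].
  rewrite setTI; apply/seteqP; split => t /=.
    move=> /cvg_enormP u_to_l.
    have dist_cvg : dist ^~ t @ \oo --> 0%E by apply: cvg_EFin => //; exact: nearW.
    by have [_ ->] := cvg_limn_einf_sup dist_cvg.
  move=> limsup_le; apply/cvg_enormP.
  have /fine_cvgP[_] : dist ^~ t @ \oo --> 0%E.
    by apply: limn_esup_le_cvg limsup_le _ => k; rewrite lee_fin enorm_ge0.
  by [].
apply: emeasurable_fun_infty_c => //; exact: measurable_fun_limn_esup.
Qed.

Lemma measurable_box (a b : 'I_n -> R) : measurable (box a b).
Proof.
have -> : box a b =
    \bigcap_(i : 'I_n) ((fun t : n.-tuple R => tnth t i) @^-1` `[a i, b i]).
  apply/seteqP; split => [t tab i _ | t tab i]; first by rewrite /= in_itv /= tab.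
  by have := tab i I; rewrite /= in_itv.
apply: fin_bigcap_measurable => [|i _]; first exact: finite_finset.
rewrite -[X in measurable X]setTI; exact: measurable_tnth.
Qed.

End tuple_measurability.

Section null_sets.
Context {R : realType} {n : nat}.

Lemma lebesgue_null_measurable_cover (A : set (n.-tuple R)) : lebesgue_null A ->
  exists B, [/\ measurable B, A `<=` B & lebesgue_null B].
Proof.
move=> A_null; have e0 j : 0 < j.+1%:R^-1 :> R by rewrite invr_gt0.
have /choice[a /choice[b ab]] := fun j => A_null _ (e0 j).
exists (\bigcap_j \bigcup_k box (a j k) (b j k)); split.
- apply: bigcapT_measurable => j; apply: bigcup_measurable => k _.
  exact: measurable_box.
- by move=> t At j _; have [_ [sub _]] := ab j; exact: sub.
move=> eps eps0; have [ab_le [_ vol_le]] := ab (Num.truncn eps^-1).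
exists (a (Num.truncn eps^-1)), (b (Num.truncn eps^-1)); split => //; split.
  by move=> t; apply.
move=> N; apply: le_trans (vol_le N) _.
by rewrite -[leRHS]invrK lef_pV2 ?posrE ?invr_gt0 // ltW // truncnS_gt.
Qed.

Lemma abs_cont_negligible (nu : {measure set (n.-tuple R) -> \bar R})
    (A : set (n.-tuple R)) :
  abs_cont_lebesgue nu -> lebesgue_null A -> nu.-negligible A.
Proof.
move=> nu_ac /lebesgue_null_measurable_cover[B [B_meas AB B_null]].
by exists B; split => //; exact: nu_ac.
Qed.

(* In dimension [0] every box has volume [1], so that no set is [lebesgue_null]. *)
Lemma jordan_null_lebesgue_null (A : set 'rV[R]_n) : (0 < n)%N -> jordan_null A ->
  lebesgue_null (@tuple_to_row R n @^-1` A).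
Proof.
move=> n0 A_null eps eps0; have n2 : 0 < 2 ^+ n :> R by rewrite exprn_gt0.
have [cs [h [h0 cs_le A_cover]]] := A_null _ (divr_gt0 eps0 n2).
pose side k : R := if (k < size cs)%N then h else 0.
have side_ge0 k : 0 <= side k by rewrite /side; case: ifP.
exists (fun k i => cs`_k 0 i - side k), (fun k i => cs`_k 0 i + side k).
split=> [k i|]; first by have := side_ge0 k; lra.
split=> [t /A_cover[c c_cs tc]|N].
  have c_lt : (index c cs < size cs)%N by rewrite index_mem.
  exists (index c cs) => // i; rewrite nth_index // /side c_lt.
  have := le_trans (normr_coord_le_enorm _ i) tc; rewrite !mxE ler_norml.
  by move=> /andP[t_ge t_le]; apply/andP; split; lra.
have vol k : box_vol (fun i => cs`_k 0 i - side k) (fun i => cs`_k 0 i + side k) =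
    (2 * h) ^+ n *+ (k < size cs)%N.
  rewrite /box_vol (eq_bigr (fun=> 2 * side k)) => [|i _]; last by ring.
  rewrite prodr_const card_ord /side; case: ifP => // _.
  by rewrite mulr0 expr0n gtn_eqF.
under eq_bigr do rewrite vol.
apply: le_trans (_ : (2 * h) ^+ n *+ size cs <= _); last first.
  by rewrite exprMn -mulr_natl mulrCA mulrC -ler_pdivlMr.
rewrite sumrMnr; apply: ler_wpMn2l; first by rewrite exprn_ge0 ?mulr_ge0.
have count_le : (\sum_(k < N) (k < size cs) <= minn N (size cs))%N.
  elim: N => [|N IHN]; first by rewrite big_ord0.
  rewrite big_ord_recr leq_min /= (leq_trans (leq_add IHN (leq_b1 _))) ?addn1 ?ltnS
    ?geq_minl //.
  have [N_lt|_] := ltnP; last by rewrite addn0 (leq_trans IHN) ?geq_minr.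
  by rewrite addn1 (leq_ltn_trans _ N_lt) // (leq_trans IHN) ?geq_minl.
by rewrite (leq_trans count_le) // geq_minr.
Qed.

End null_sets.

Section basin_of_attraction.
Context {R : realType} {n : nat}.
Variables (T : 'rV[R]_n -> 'rV[R]_n) (S : 'M[R]_n) (w a : 'rV[R]_n) (r : R).
Hypothesis T_bilip : bilipschitz T.
Hypothesis w_neg : quad S w < 0.
Hypothesis r_gt0 : 0 < r.
Hypothesis T_cone : forall x y, eball a r x -> eball a r y ->
  quad S (x - y) <= 0 -> quad S (T x - T y) <= quad S (x - y).

Definition local_basin : set 'rV[R]_n :=
  [set x | iter k T x @[k --> \oo] --> a /\ forall k, eball a r (iter k T x)].

Lemma local_basin_cone_free x y : local_basin x -> local_basin y ->
  0 <= quad S (x - y).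
Proof.
move=> [x_cvg x_near] [y_cvg y_near].
rewrite leNgt; apply/negP => xy_neg; suff: 0 <= quad S (x - y) by rewrite leNgt xy_neg.
have le_start k : quad S (iter k T x - iter k T y) <= quad S (x - y).
  elim: k => [//|k IHk]; apply: le_trans (IHk).
  exact: T_cone (x_near k) (y_near k) (le_trans IHk (ltW xy_neg)).
have diff_cvg : iter k T x - iter k T y @[k --> \oo] --> (0 : 'rV[R]_n).
  by rewrite -(subrr a); exact: cvgB.
by apply: (cvgr_to_le (cvg_quad0 S diff_cvg)); exact: nearW.
Qed.

Lemma local_basin_jordan_null : jordan_null local_basin.
Proof.
apply: (cone_free_jordan_null (B := r + enorm a) w_neg _ local_basin_cone_free).
move=> x [_ /(_ 0%N) x_near]; rewrite -[x](subrK a).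
by apply: le_trans (ler_enormD _ _) _; rewrite lerD2r.
Qed.

Lemma basin_subset_bigcup :
  [set x | iter k T x @[k --> \oo] --> a] `<=` \bigcup_m (iter m T @^-1` local_basin).
Proof.
move=> x /= x_cvg; have /cvg_enormP/cvgr_le/(_ _ r_gt0)[m _ m_near] := x_cvg.
exists m => //; split => [|k]; rewrite /= -?iterD; last by apply: m_near; exact: leq_addl.
have -> : (fun k => iter k T (iter m T x)) = (fun k => iter (k + m) T x).
  by apply/funext => k; rewrite iterD.
by rewrite (cvg_shiftn m (fun k => iter k T x)).
Qed.

Lemma basin_negligible (nu : {measure set (n.-tuple R) -> \bar R}) :
  abs_cont_lebesgue nu ->
  nu.-negligible [set t | iter k T (tuple_to_row t) @[k --> \oo] --> a].
Proof.
move=> nu_ac; have n_gt0 : (0 < n)%N.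
  rewrite lt0n; apply: contraTneq w_neg => n0.
  have -> : w = 0 by apply/rowP => -[i i_lt]; exfalso; move: i_lt; rewrite n0.
  by rewrite /quad dotv0r ltxx.
apply: negligibleS (_ : _ `<=` \bigcup_m (@tuple_to_row R n @^-1`
  (iter m T @^-1` local_basin))) _.
  by move=> t /basin_subset_bigcup.
apply: negligible_bigcup => m; apply: abs_cont_negligible => //.
apply: jordan_null_lebesgue_null => //; apply: jordan_null_preimage.
  exact: bilipschitz_iter.
exact: local_basin_jordan_null.
Qed.

End basin_of_attraction.

Theorem theorem6 (R : realType) (n p : nat) (nt : 'I_p -> nat)
    (f : 'rV[R]_n -> R) (L alpha : R) (xstar : 'rV[R]_n)
    (nu : probability (n.-tuple R) R) :
  (forall t, 0 < nt t)%N ->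
  (\sum_(t < p) nt t)%N = n ->
  C2 f -> 0 < L -> grad_lipschitz f L ->
  strict_saddle f xstar ->
  0 < alpha -> alpha < L^-1 ->
  abs_cont_lebesgue nu ->
  nu [set t | pbcd f alpha nt k (tuple_to_row t) @[k --> \oo] --> xstar] = 0%E.
Proof.
move=> _ sum_nt f_C2 L_gt0 f_lip saddle alpha_gt0 alpha_lt nu_ac.
have alphaL_lt1 : alpha * L < 1 by rewrite -ltr_pdivlMr // div1r.
have [grad0 [lam [lam_eigen lam_lt0]]] := saddle; have L_ge0 := ltW L_gt0.
have sweep_bilip : bilipschitz (pbcd_sweep f alpha nt).
  exact: pbcd_sweep_bilipschitz f_lip _ _ _.
have [S [w [r [w_neg r_gt0 sweep_cone]]]] := pbcd_sweep_cone f_C2 f_lip L_ge0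
  alpha_gt0 alphaL_lt1 grad0 sum_nt lam_eigen lam_lt0.
apply: measure_negligible; last exact: basin_negligible w_neg r_gt0 sweep_cone nu nu_ac.
apply: (measurable_cvg_tuple (u := pbcd f alpha nt)) => k.
exact/bilipschitz_continuous/bilipschitz_iter.
Qed.
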